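(* For every $n\ge3$ and every $\mathfrak{e}\in[0,1)$, the subsystem $\mathcal{B}_1$ of the regular $n$-gon elliptic relative equilibrium is hyperbolic; that is, the fundamental solution $\eta_{1,\mathfrak{e}}$ of $$\eta_{1,\mathfrak{e}}'(\theta)=J_4\mathcal{B}_1(\theta)\eta_{1,\mathfrak{e}}(\theta),\qquad\eta_{1,\mathfrak{e}}(0)=I_4$$ has the property that $\eta_{1,\mathfrak{e}}(2\pi)$ has no eigenvalue on the unit circle. Consequently, for every $n\ge 3$ and every $\mathfrak{e}\in[0,1)$ the regular $n$-gon elliptic relative equilibrium is spectrally unstable.
   Context: The regular $n$-gon elliptic relative equilibrium (ERE) of eccentricity $\mathfrak{e}\in[0,1)$ is the homographic Kepler solution of the planar Newtonian $n$-body problem in which $n$ unit masses stay at the vertices of a regular $n$-gon, each moving on a Kepler ellipse of eccentricity $\mathfrak{e}$. In suitable symplectic coordinates, with the true anomaly $\theta\in[0,2\pi]$ as independent variable, its linearized Hamiltonian system splits as a symplectic direct sum of a translation part, a dilation/rotation (Kepler) part, and an essential part $\eta_{\mathfrak{e}}'=JB_3(\theta)\eta_{\mathfrak{e}}$, $\eta_{\mathfrak{e}}(0)=I$, of dimension $4n-8$, where $B_3=\mathcal{B}_1\diamond\cdots\diamond\mathcal{B}_{[n/2]}$, $$\mathcal{B}_l(\theta)=\begin{pmatrix}I&-\mathbb{J}\\ \mathbb{J}&I-\frac{I+\mathcal{U}_l}{1+\mathfrak{e}\cos\theta}\end{pmatrix}.$$ Here $J=J_{2j}=\begin{pmatrix}0_j&-I_j\\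 I_j&0_j\end{pmatrix}$, $\mathbb{J}=\mathrm{diag}(J_2,\dots,J_2)$, with $I,\mathbb{J}$ of the size of $\mathcal{U}_l$; $[x]$ is the integer part; and for $M_1=\begin{pmatrix} A_1 & A_2 \\ A_3 & A_4 \end{pmatrix}$, $M_2=\begin{pmatrix} B_1 & B_2 \\ B_3 & B_4 \end{pmatrix}$, $M_1\diamond M_2=\begin{pmatrix} A_1 & 0 & A_2 & 0 \\ 0 & B_1 & 0 & B_2 \\ A_3 & 0 & A_4 & 0 \\ 0 & B_3 & 0 & B_4 \end{pmatrix}$. With $\theta_j=2\pi j/n$, $\theta_{jl}=2\pi jl/n$, $d_{nj}=2\sin\frac{\pi j}n$, $\lambda=\frac14\sum_{j=1}^{n-1}\csc\frac{\pi j}n$: $$\mathcal{U}_1=\frac z\lambda I_2,\quad z=\sum_{j=1}^{n-1}\frac{1-\cos2\theta_j}{2d_{nj}^3},\qquad \mathcal{U}_l=\frac1\lambda\begin{pmatrix} a_l & 0 & 0 & S_l \\ 0 & b_l & -S_l & 0 \\ 0 & -S_l & a_l & 0 \\ S_l & 0 & 0 & b_l \end{pmatrix}\ (2\le l\le[\tfrac{n-1}2]),\quad \mathcal{U}_{n/2}=\frac1\lambda\,\mathrm{diag}(a_{n/2},b_{n/2})\ (n\text{ even}),$$ $a_l=P_l-3Q_l$, $b_l=P_l+3Q_l$, $P_l=\sum_{j=1}^{n-1}\frac{1-\cos\theta_{jl}\cos\theta_j}{2d_{nj}^3}$, $S_l=\sum_{j=1}^{n-1}\frac{\sin\theta_{jl}\sin\theta_j}{2d_{nj}^3}$,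 $Q_l=\sum_{j=1}^{n-1}\frac{\cos\theta_j-\cos\theta_{jl}}{2d_{nj}^3}$. A linear $2\pi$-periodic Hamiltonian system is hyperbolic if its monodromy matrix has no eigenvalue on the unit circle $\mathbb{U}\subset\mathbb{C}$. The ERE is spectrally stable if all eigenvalues of $\eta_{\mathfrak{e}}(2\pi)$ lie on $\mathbb{U}$, and spectrally unstable otherwise. *)

(* Defs.v *)
From HB Require Import structures.
From mathcomp Require Import all_boot all_order all_algebra.
From mathcomp Require Import complex.
From mathcomp Require Import all_classical all_reals all_analysis.
From mathcomp Require Import zify.
Set Implicit Arguments.
Unset Strict Implicit.
Unset Printing Implicit Defensive.
Import Order.TTheory GRing.Theory Num.Theory.
Local Open Scope ring_scope.

Definition mx_of_rows (R : realType) (m n : nat) (s : seq (seq R)) : 'M[R]_(m, n) :=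
  \matrix_(i < m, j < n) nth 0 (nth [::] s i) j.

(* J_{2j}, acting on a phase space with j positions and j momenta. *)
Definition J (R : realType) (j : nat) : 'M[R]_(j + j) :=
  block_mx 0 (- 1%:M) 1%:M 0.

(* diag(J_2, ..., J_2), of size p; meant for even p. *)
Definition bbJ (R : realType) (p : nat) : 'M[R]_p :=
  \matrix_(i < p, j < p)
    (if odd i && (i == j.+1 :> nat) then 1
     else if odd j && (j == i.+1 :> nat) then -1 else 0).

Lemma bbJ2 (R : realType) : bbJ R 2 = J R 1.
Proof.
apply/matrixP => i j; rewrite !mxE.
case: splitP => i' ei; rewrite !mxE; case: splitP => j' ej; rewrite !mxE;
  rewrite ei ej !ord1 //=.
Qed.

Lemma bbJ4 (R : realType) : bbJ R 4 = block_mx (J R 1) 0 0 (J R 1) :> 'M[R]_(2 + 2).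
Proof.
rewrite -bbJ2; apply/matrixP => i j; rewrite !mxE.
by case: splitP => i' ei; rewrite !mxE; case: splitP => j' ej; rewrite !mxE ei ej;
  move: i' j' {ei ej} => [[|[|?]] ?] [[|[|?]] ?].
Qed.

Section Coefficients.
Variables (R : realType) (n : nat).

(* theta_{jl}; theta_j is theta j 1. *)
Definition theta (j l : nat) : R := 2 * pi * j%:R * l%:R / n%:R.

Definition dn (j : nat) : R := 2 * sin (pi * j%:R / n%:R).

Definition lambda : R := 4^-1 * \sum_(1 <= j < n) (sin (pi * j%:R / n%:R))^-1.

Definition zn : R :=
  \sum_(1 <= j < n) (1 - cos (2 * theta j 1)) / (2 * dn j ^+ 3).

Definition Pl (l : nat) : R :=
  \sum_(1 <= j < n) (1 - cos (theta j l) * cos (theta j 1)) / (2 * dn j ^+ 3).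

Definition Sl (l : nat) : R :=
  \sum_(1 <= j < n) (sin (theta j l) * sin (theta j 1)) / (2 * dn j ^+ 3).

Definition Ql (l : nat) : R :=
  \sum_(1 <= j < n) (cos (theta j 1) - cos (theta j l)) / (2 * dn j ^+ 3).

Definition al (l : nat) : R := Pl l - 3 * Ql l.

Definition bl (l : nat) : R := Pl l + 3 * Ql l.

Definition usize (l : nat) : nat := (if (l == 1) || (l.*2 == n) then 2 else 4)%N.

(* U_l for 1 <= l <= [n/2] and n >= 3. *)
Definition U (l : nat) : 'M[R]_(usize l) :=
  if ((l == 1) || (l.*2 == n))%N as c return 'M[R]_(if c then 2%N else 4%N) then
    if l == 1%N then (zn / lambda) *: 1%:M
    else lambda^-1 *: mx_of_rows 2 2 [:: [:: al l; 0]; [:: 0; bl l]]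
  else
    lambda^-1 *: mx_of_rows 4 4
      [:: [:: al l; 0;     0;     Sl l];
          [:: 0;   bl l;   - Sl l; 0  ];
          [:: 0;   - Sl l; al l;   0  ];
          [:: Sl l; 0;     0;     bl l]].

(* e is the eccentricity and t the true anomaly. *)
Definition B (e : R) (l : nat) (t : R) : 'M[R]_(usize l + usize l) :=
  block_mx 1%:M            (- bbJ R (usize l))
           (bbJ R (usize l)) (1%:M - (1 + e * cos t)^-1 *: (1%:M + U l)).

End Coefficients.

Definition diamond (R : realType) (p q : nat) (M1 : 'M[R]_(p + p)) (M2 : 'M[R]_(q + q)) :
    'M[R]_((p + q) + (p + q)) :=
  block_mx (block_mx (ulsubmx M1) 0 0 (ulsubmx M2)) (block_mx (ursubmx M1) 0 0 (ursubmx M2))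
           (block_mx (dlsubmx M1) 0 0 (dlsubmx M2)) (block_mx (drsubmx M1) 0 0 (drsubmx M2)).

Fixpoint diamond_size (p : nat -> nat) (k : nat) : nat :=
  (if k is k'.+1 then diamond_size p k' + p k'.+1 else 0)%N.

(* M_1 <> ... <> M_k, bracketed to the left; the 0 x 0 matrix is the unit of <>. *)
Fixpoint diamonds (R : realType) (p : nat -> nat) (M : forall l, 'M[R]_(p l + p l)) (k : nat) :
    'M[R]_(diamond_size p k + diamond_size p k) :=
  if k is k'.+1 then diamond (diamonds M k') (M k'.+1) else 0.

Definition essential_size (n : nat) : nat := diamond_size (usize n) n./2.

Lemma essential_sizeE (n : nat) : (3 <= n)%N ->
  (essential_size n + essential_size n = 4 * n - 8)%N.
Proof.
move=> n3.
have H k : (0 < k)%N -> (k.*2 < n)%N -> diamond_size (usize n) k = (4 * k - 2)%N.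
  elim: k => // -[_ _ hk|k IH _ hk]; first by rewrite /= /usize.
  rewrite [LHS]/= -/(diamond_size _ k.+1) IH //; last by lia.
  by rewrite /usize ifF; lia.
rewrite /essential_size.
have [on|en] := boolP (odd n).
  by rewrite H; lia.
have -> : n./2 = n./2.-1.+1 by lia.
rewrite [diamond_size _ _]/= H; [|lia|lia].
by rewrite /usize ifT; lia.
Qed.

Definition B3 (R : realType) (n : nat) (e t : R) :
    'M[R]_(essential_size n + essential_size n) :=
  diamonds (fun l => B n e l t) n./2.

Definition fundamental_solution (R : realType) (p : nat)
    (H eta : R -> 'M[R]_(p + p)) : Prop :=
  eta 0 = 1%:M /\
  forall (t : R) (i j : 'I_(p + p)),
    is_derive t (1 : R) (fun s : R => eta s i j) ((J R p *m H t *m eta t) i j).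

Definition complex_eigenvalue (R : realType) (m : nat) (M : 'M[R]_m) (w : R[i]) : Prop :=
  eigenvalue (map_mx (real_complex R) M) w.

(* Both predicates below apply to a monodromy matrix. *)
Definition hyperbolic (R : realType) (m : nat) (M : 'M[R]_m) : Prop :=
  forall w : R[i], complex_eigenvalue M w -> `|w| <> 1.

Definition spectrally_stable (R : realType) (m : nat) (M : 'M[R]_m) : Prop :=
  forall w : R[i], complex_eigenvalue M w -> `|w| = 1.

(* Main.v *)
(** With [f = 1 + e cos t], [u = z / lambda > 0] and [g = f' / f], the block [B_1]
    is the planar equation [q'' + 2 J q' = (1 + u) / f * q] in the momenta
    [p = q' + J q].  In a rotating frame it becomes [w'' = ((1 + u) / f - 1) w],
    for which [f] is a positive strict supersolution because [f'' = 1 - f].  The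
    corresponding Riccati energy [E = <q, p> - g |q|^2] satisfies
    [E' = |p - g q|^2 + (u / f) |q|^2], so it increases strictly along nonzero
    solutions.  At [0] and [2 pi] one has [g = 0] and [E = <q, p>]; an eigenvector
    for a multiplier on the unit circle, split into real and imaginary parts, would
    have the same total energy at both times.
    Projecting the essential part onto its first block intertwines it with [B_1],
    by uniqueness for the linear equation, so every left eigenvector of the monodromy
    of [B_1] lifts to one of the whole essential monodromy. *)
Require Import Defs.
From mathcomp Require Import all_boot all_order all_algebra.
From mathcomp Require Import complex.
From mathcomp Require Import all_classical all_reals all_analysis.
From mathcomp Require Import ring lra.
Import Order.TTheory GRing.Theory Num.Theory.
Import numFieldNormedType.Exports.
Local Open Scope ring_scope.
Set Implicit Arguments.
Unset Strict Implicit.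
Unset Printing Implicit Defensive.

(** * Scalar differentiation rules and energy estimates *)

Section PointwiseDerivatives.
Variables (R : realType) (f g : R -> R) (t df dg : R).
Hypotheses (hf : is_derive t (1 : R) f df) (hg : is_derive t (1 : R) g dg).

Lemma is_derive_ptD : is_derive t (1 : R) (fun s => f s + g s) (df + dg).
Proof. exact: is_deriveD. Qed.

Lemma is_derive_ptB : is_derive t (1 : R) (fun s => f s - g s) (df - dg).
Proof. exact: is_deriveB. Qed.

Lemma is_derive_ptM :
  is_derive t (1 : R) (fun s => f s * g s) (f t * dg + g t * df).
Proof. exact: is_deriveM. Qed.

Lemma is_derive_pt_sqr : is_derive t (1 : R) (fun s => f s ^+ 2) (2 * f t * df).
Proof. by apply: (is_derive_eq (is_deriveX 2 hf)); rewrite expr1. Qed.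

Lemma is_derive_ptV : f t != 0 ->
  is_derive t (1 : R) (fun s => (f s)^-1) (- (f t)^-1 ^+ 2 * df).
Proof. by move=> f0; apply: (is_derive_eq (is_deriveV f0 hf)); rewrite exprVn. Qed.

Lemma is_derive_ptZ (c : R) : is_derive t (1 : R) (fun s => c * f s) (c * df).
Proof. exact: is_deriveZ. Qed.

End PointwiseDerivatives.

(** With [f = 1 + e cos t], this is the Riccati equation of [g = f' / f]: [g' = f'' / f - g^2] and
    [f'' = 1 - f]. *)
Lemma is_derive_sin_conic (R : realType) (e t : R) : 1 + e * cos t != 0 ->
  is_derive t (1 : R) (fun s => - e * sin s / (1 + e * cos s))
    ((1 + e * cos t)^-1 - 1 - (- e * sin t / (1 + e * cos t)) ^+ 2).
Proof.
move=> f0.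
have hs := is_derive_ptZ (is_derive_sin t) (- e).
have h1 : is_derive t (1 : R) (fun=> 1 : R) 0 by exact: is_derive_cst.
have hf := is_derive_ptD h1 (is_derive_ptZ (is_derive_cos t) e).
apply: (is_derive_eq (is_derive_ptM hs (is_derive_ptV hf f0))).
by rewrite add0r; field.
Qed.

(** A monotone [F] with [F T <= F 0] would be constant on [[0, T]], so its right difference
    quotients at [0] would vanish. *)
Lemma lt_of_derive_ge0_gt0 (R : realType) (F dF : R -> R) (T : R) :
  (forall t, is_derive t (1 : R) F (dF t)) -> (forall t, 0 <= dF t) ->
  0 < dF 0 -> 0 < T -> F 0 < F T.
Proof.
move=> hF dF_ge0 dF0 T0.
have le_F s t : s <= t -> F s <= F t.
  rewrite le_eqVlt => /predU1P[->//|st].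
  have [|c _] := MVT st (fun x _ => hF x).
    apply: derivable_within_continuous => x _; exact: ex_derive.
  move=> hc; rewrite -subr_ge0 hc mulr_ge0 // subr_ge0 ltW //.
rewrite ltNge; apply/negP => FT.
have [h1 h2] := hF 0.
have : (h^-1 *: ((F \o shift 0) (h *: (1 : R)) - F 0) @[h --> (0 : R)^'] --> dF 0)%classic.
  by rewrite -h2; exact: h1.
move=> /cvg_dnbhs_at_right /cvgr_gt => /(_ _ dF0) hpos.
have [h [[hT h0] /=]] := filter_ex (filterI (filterI (nbhs_right_lt T0) (nbhs_right_gt 0)) hpos).
rewrite addr0 /GRing.scale /= mulr1.
have -> : F h = F 0.
  by apply/eqP; rewrite eq_le (le_trans (le_F _ _ (ltW hT)) FT) le_F // ltW.
by rewrite subrr mulr0 ltxx.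
Qed.

(* First-order form of [q'' + 2 J q' = k q] with [p = q' + J q], [J] the rotation
   by a quarter turn. *)
Record rotating_kepler_solution (R : realType) (k p1 p2 q1 q2 : R -> R) : Prop :=
  RotatingKeplerSolution {
    rk_p1 : forall t, is_derive t (1 : R) p1 (p2 t + (k t - 1) * q1 t);
    rk_p2 : forall t, is_derive t (1 : R) p2 (- p1 t + (k t - 1) * q2 t);
    rk_q1 : forall t, is_derive t (1 : R) q1 (p1 t + q2 t);
    rk_q2 : forall t, is_derive t (1 : R) q2 (p2 t - q1 t) }.

(** The rotation terms cancel, leaving [<q, p>' = |p|^2 + (k - 1) |q|^2] and [(|q|^2)' = 2 <q, p>]
    with [k = (1 + u) / f]. The Riccati equation gives [k - 1 - g' = u / f + g^2], whose term [g^2]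
    completes the square. *)
Lemma is_derive_energy (R : realType) (e u : R) (p1 p2 q1 q2 : R -> R) (t : R) :
  let f := 1 + e * cos t in let g s := - e * sin s / (1 + e * cos s) in
  f != 0 ->
  rotating_kepler_solution (fun s => (1 + u) / (1 + e * cos s)) p1 p2 q1 q2 ->
  is_derive t (1 : R)
    (fun s => q1 s * p1 s + q2 s * p2 s - g s * (q1 s ^+ 2 + q2 s ^+ 2))
    ((p1 t - g t * q1 t) ^+ 2 + (p2 t - g t * q2 t) ^+ 2
     + u / f * (q1 t ^+ 2 + q2 t ^+ 2)).
Proof.
move=> f g f0 [hp1 hp2 hq1 hq2].
have hg := is_derive_sin_conic f0.
apply: (is_derive_eq (is_derive_ptB
  (is_derive_ptD (is_derive_ptM (hq1 t) (hp1 t)) (is_derive_ptM (hq2 t) (hp2 t)))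
  (is_derive_ptM hg
    (is_derive_ptD (is_derive_pt_sqr (hq1 t)) (is_derive_pt_sqr (hq2 t)))))).
by rewrite /g -/f; field.
Qed.

(** The weighted function [N s * expR (- C * s)] starts at [0] and has nonpositive derivative. *)
Lemma gronwall_eq0 (R : realType) (N dN : R -> R) (C : R) :
  (forall t, is_derive t (1 : R) N (dN t)) -> (forall t, 0 <= N t) ->
  (forall t, dN t <= C * N t) -> N 0 = 0 ->
  forall t, 0 <= t -> N t = 0.
Proof.
move=> hN N_ge0 hC N0 t; rewrite le_eqVlt => /predU1P[<-//|t0].
pose G s := N s * expR (- C * s).
have hG s : is_derive s (1 : R) G (expR (- C * s) * (dN s - C * N s)).
  have he : is_derive s (1 : R) (fun s => expR (- C * s)) _ :=
    is_derive1_comp (is_derive_expR _) (is_derive_ptZ (is_derive_id _ _) _).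
  by apply: (is_derive_eq (is_derive_ptM (hN s) he)); ring.
have [|c _ hc] := MVT t0 (fun x _ => hG x).
  apply: derivable_within_continuous => x _; exact: ex_derive.
have : G t <= 0.
  have : G t - G 0 <= 0.
    by rewrite hc subr0 mulr_le0_ge0 ?(ltW t0) // mulr_ge0_le0 ?expR_ge0 // subr_le0.
  by rewrite /G N0 mul0r subr0.
rewrite /G pmulr_lle0 ?expR_gt0 // => Nt.
by apply/eqP; rewrite eq_le Nt N_ge0.
Qed.

Lemma rotating_kepler_eq0 (R : realType) (k p1 p2 q1 q2 : R -> R) (C : R) :
  (forall t, 0 <= k t <= C) -> rotating_kepler_solution k p1 p2 q1 q2 ->
  p1 0 = 0 -> p2 0 = 0 -> q1 0 = 0 -> q2 0 = 0 ->
  forall t, 0 <= t -> [/\ p1 t = 0, p2 t = 0, q1 t = 0 & q2 t = 0].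
Proof.
move=> hk [hp1 hp2 hq1 hq2] p10 p20 q10 q20 t t0.
pose N s := p1 s ^+ 2 + p2 s ^+ 2 + q1 s ^+ 2 + q2 s ^+ 2.
have hN s : is_derive s (1 : R) N (2 * k s * (q1 s * p1 s + q2 s * p2 s)).
  apply: (is_derive_eq (is_derive_ptD (is_derive_ptD (is_derive_ptD
    (is_derive_pt_sqr (hp1 s)) (is_derive_pt_sqr (hp2 s)))
    (is_derive_pt_sqr (hq1 s))) (is_derive_pt_sqr (hq2 s)))).
  by ring.
have N_ge0 s : 0 <= N s by rewrite /N !addr_ge0 ?sqr_ge0.
have /eqP : N t = 0.
  apply: (gronwall_eq0 (C := C) hN) => // [s|]; last first.
    by rewrite /N p10 p20 q10 q20 expr0n /= !addr0.
  have /andP[k0 kC] := hk s.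
  (* By [2 <q, p> <= |p|^2 + |q|^2], the derivative of [N] is at most [k N <= C N]. *)
  have := ler_wpM2r (N_ge0 s) kC; apply: le_trans.
  rewrite mulrC (mulrC (k s)) !mulrA ler_wpM2r // /N.
  have := sqr_ge0 (p1 s - q1 s); have := sqr_ge0 (p2 s - q2 s); nra.
by rewrite /N !paddr_eq0 ?addr_ge0 ?sqr_ge0 // !sqrf_eq0
  => /andP[/andP[/andP[/eqP-> /eqP->] /eqP->] /eqP->].
Qed.

(** * Positivity of the polygon sums *)

Lemma onem_cos2 (R : realType) (x : R) : 1 - cos (2 * x) = 2 * sin x ^+ 2.
Proof. by rewrite mulr_natl cos_mulr2n sin2cos2; ring. Qed.

Section PolygonCoefficients.
Variables (R : realType) (n : nat).

Lemma sin_polygon_gt0 (j : nat) : (0 < j < n)%N -> 0 < sin (pi * j%:R / n%:R : R).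
Proof.
move=> /andP[j0 jn]; have n0 : 0 < n%:R :> R by rewrite ltr0n (leq_trans _ jn).
have j0' : 0 < j%:R :> R by rewrite ltr0n.
apply: sin_gt0_pi; rewrite divr_gt0 ?mulr_gt0 ?pi_gt0 //=.
by rewrite ltr_pdivrMr // ltr_pM2l ?pi_gt0 // ltr_nat.
Qed.

Lemma lambda_gt0 : (1 < n)%N -> 0 < lambda R n.
Proof.
move=> n1; rewrite mulr_gt0 ?invr_gt0 // big_ltn // ltr_pwDl //.
  by rewrite invr_gt0 sin_polygon_gt0.
rewrite big_nat_cond sumr_ge0 // => j /andP[/andP[j1 jn] _].
by rewrite invr_ge0 ltW // sin_polygon_gt0 // jn ltnW.
Qed.

Lemma zn_gt0 : (2 < n)%N -> 0 < zn R n.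
Proof.
move=> n2; have d_gt0 j : (0 < j < n)%N -> 0 < 2 * dn R n j ^+ 3.
  by move=> hj; rewrite mulr_gt0 // exprn_gt0 // mulr_gt0 // sin_polygon_gt0.
rewrite /zn big_ltn ?(ltnW n2) // ltr_pwDl //.
  rewrite divr_gt0 ?d_gt0 ?(ltnW n2) // onem_cos2 mulr_gt0 // exprn_gt0 //.
  (* The term [j = 1] contains the sine of [2 pi / n], the polygon angle of index [2]; it is
     positive because [2 < n]. *)
  have -> : theta R n 1 1 = pi * 2%:R / n%:R by rewrite /theta; ring.
  exact: sin_polygon_gt0.
rewrite big_nat_cond sumr_ge0 // => j /andP[/andP[j1 jn] _].
have hd : 0 < 2 * dn R n j ^+ 3 by rewrite d_gt0 // jn ltnW.
by rewrite divr_ge0 ?(ltW hd) // onem_cos2 mulr_ge0 ?sqr_ge0.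
Qed.

End PolygonCoefficients.

(** * Entrywise derivatives of matrix functions *)

Definition mx_is_derive (R : realType) (m n : nat) (X : R -> 'M[R]_(m, n))
    (t : R) (D : 'M[R]_(m, n)) : Prop :=
  forall i j, is_derive t (1 : R) (fun s => X s i j) (D i j).

Section MatrixDerivative.
Variable R : realType.

Lemma mx_is_deriveMl (m n p : nat) (A : 'M[R]_(m, n)) (X : R -> 'M[R]_(n, p)) t D :
  mx_is_derive X t D -> mx_is_derive (fun s => A *m X s) t (A *m D).
Proof.
move=> hX i j; rewrite mxE; under eq_fun do rewrite mxE.
rewrite -fct_sumE; apply: is_derive_sum => k; exact: is_derive_ptZ.
Qed.

Lemma mx_is_deriveMr (m n p : nat) (A : 'M[R]_(n, p)) (X : R -> 'M[R]_(m, n)) t D :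
  mx_is_derive X t D -> mx_is_derive (fun s => X s *m A) t (D *m A).
Proof.
move=> hX i j; rewrite mxE; under eq_fun do rewrite mxE.
rewrite -fct_sumE; apply: is_derive_sum => k.
by rewrite mulrC; under eq_fun do rewrite mulrC; exact: is_derive_ptZ.
Qed.

Lemma mx_is_deriveB (m n : nat) (X Y : R -> 'M[R]_(m, n)) t D E :
  mx_is_derive X t D -> mx_is_derive Y t E ->
  mx_is_derive (fun s => X s - Y s) t (D - E).
Proof.
move=> hX hY i j; rewrite !mxE; under eq_fun do rewrite !mxE.
exact: is_derive_ptB.
Qed.

End MatrixDerivative.

(** * The first block as a rotating Kepler equation *)

Section FirstBlock.
Variables (R : realType) (n : nat) (e : R).
Let u : R := zn R n / lambda R n.
Let k (t : R) : R := (1 + u) / (1 + e * cos t).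

Lemma JB1_mulE (t : R) (p : nat) (x : 'M[R]_(2 + 2, p)) :
  J R 2 *m B n e 1 t *m x =
  col_mx ((k t - 1) *: dsubmx x - bbJ R 2 *m usubmx x)
         (usubmx x - bbJ R 2 *m dsubmx x).
Proof.
(* [usize n 1] computes to [2] and [U] at index [1] to [u I], so this holds by conversion. *)
have -> : B n e 1 t = block_mx 1%:M (- bbJ R 2) (bbJ R 2)
    (1%:M - (1 + e * cos t)^-1 *: (1%:M + u *: 1%:M)) :> 'M[R]_(2 + 2) by [].
rewrite -{1}[x]vsubmxK /J mulmx_block mul_block_col !mul0mx !add0r !addr0 !mulNmx !mul1mx.
rewrite addrC -mulNmx; congr (col_mx (_ + _) _); last by rewrite mulNmx.
have -> : - (1%:M - (1 + e * cos t)^-1 *: (1%:M + u *: 1%:M)) = (k t - 1)%:M :> 'M[R]_2.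
  by rewrite opprB scalemx1 -raddfD scale_scalar_mx -raddfB [_^-1 * _]mulrC.
exact: mul_scalar_mx.
Qed.

(** The upper two coordinates are the momenta, the lower two the positions. *)
Lemma rotating_kepler_of_B1 (X : R -> 'cV[R]_(2 + 2)) :
  (forall t, mx_is_derive X t (J R 2 *m B n e 1 t *m X t)) ->
  rotating_kepler_solution k
    (fun t => X t (lshift 2 0) 0) (fun t => X t (lshift 2 1) 0)
    (fun t => X t (rshift 2 0) 0) (fun t => X t (rshift 2 1) 0).
Proof.
have l1 : lift ord0 ord0 = 1 :> 'I_2 by exact: val_inj.
move=> hX; split=> t;
  [have := hX t (lshift 2 0) 0 | have := hX t (lshift 2 1) 0
  | have := hX t (rshift 2 0) 0 | have := hX t (rshift 2 1) 0];
  rewrite JB1_mulE ?col_mxEu ?col_mxEd !mxE !big_ord_recl big_ord0 !mxE /= l1;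
  by move=> h; apply: (is_derive_eq h); ring.
Qed.

Lemma col4_eq0 (x : 'cV[R]_(2 + 2)) :
  x (lshift 2 0) 0 = 0 -> x (lshift 2 1) 0 = 0 ->
  x (rshift 2 0) 0 = 0 -> x (rshift 2 1) 0 = 0 -> x = 0.
Proof.
move=> x0 x1 x2 x3.
have ord2 (P : 'I_2 -> Prop) : P 0 -> P 1 -> forall j, P j.
  move=> P0 P1 [[|[|//]] h]; [move: P0 | move: P1]; congr P; exact: val_inj.
by apply/colP => i; rewrite mxE; case: (split_ordP i) => j ->; elim/ord2: j.
Qed.

End FirstBlock.

(** * Hyperbolicity of the first block *)

Lemma real_eigenpair (R : realType) (m : nat) (M : 'M[R]_m) (w : R[i]) :
  complex_eigenvalue M w ->
  exists x y : 'cV[R]_m, [/\ ~ (x = 0 /\ y = 0),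
    M *m x = complex.Re w *: x - complex.Im w *: y &
    M *m y = complex.Im w *: x + complex.Re w *: y].
Proof.
rewrite /complex_eigenvalue eigenvalue_root_char => rw.
(* [eigenvalue] refers to row vectors; the transpose has the same characteristic polynomial and
   yields a column vector, which can serve as initial value of a solution. *)
have : eigenvalue (map_mx (real_complex R) M)^T w.
  suff tr : char_poly (map_mx (real_complex R) M)^T
      = char_poly (map_mx (real_complex R) M) by rewrite eigenvalue_root_char tr.
  rewrite /char_poly -[RHS]det_tr; congr (\det _).
  by apply/matrixP => i j; rewrite !mxE eq_sym.
case/eigenvalueP => v hv v0.
exists (\col_i complex.Re (v 0 i)), (\col_i complex.Im (v 0 i)).
have hvi i : \sum_j v 0 j * (M i j)%:C%C = w * v 0 i.
  have /matrixP/(_ 0 i) := hv; rewrite !mxE => <-.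
  by apply: eq_bigr => j _; rewrite !mxE.
split.
- case=> /colP re0 /colP im0; case/negP: v0; apply/eqP/rowP => i.
  have := re0 i; have := im0 i; rewrite !mxE.
  by case: (v 0 i) => a b /= -> ->.
- apply/colP => i; have := congr1 (@complex.Re R) (hvi i).
  rewrite raddf_sum !mxE => h; rewrite (_ : _ - _ = complex.Re (w * v 0 i)).
    rewrite -h; apply: eq_bigr => j _; rewrite !mxE.
    by case: (v 0 j) => a b /=; ring.
  by case: w {hv h hvi rw} => c d; case: (v 0 i).
- apply/colP => i; have := congr1 (@complex.Im R) (hvi i).
  rewrite raddf_sum !mxE => h; rewrite (_ : _ + _ = complex.Im (w * v 0 i)).
    rewrite -h; apply: eq_bigr => j _; rewrite !mxE.
    by case: (v 0 j) => a b /=; ring.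
  by case: w {hv h hvi rw} => c d; case: (v 0 i) => a b /=; ring.
Qed.

Lemma conic_ge (R : realType) (e t : R) : 0 <= e < 1 -> 1 - e <= 1 + e * cos t.
Proof.
case/andP=> e0 e1; have := cos_geN1 t; nra.
Qed.

Lemma B1_hyperbolic (R : realType) (n : nat) (e : R) (eta : R -> 'M[R]_(2 + 2)) :
  (2 < n)%N -> 0 <= e < 1 -> fundamental_solution (B n e 1) eta ->
  hyperbolic (eta (2 * pi)).
Proof.
move=> n2 he [eta0 deta] w /real_eigenpair [x [y [xy0 hx hy]]] w1.
have {w1} w1 : complex.Re w ^+ 2 + complex.Im w ^+ 2 = 1.
  move: w1; rewrite normc_def => -[] /(congr1 (fun r => r ^+ 2)).
  by rewrite sqr_sqrtr ?addr_ge0 ?sqr_ge0 // expr1n.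
pose u : R := zn R n / lambda R n.
have u0 : 0 < u by rewrite divr_gt0 ?zn_gt0 ?lambda_gt0 // ltnW.
pose f t : R := 1 + e * cos t.
have f0 t : 0 < f t.
  by apply: lt_le_trans (conic_ge t he); rewrite subr_gt0; case/andP: he.
pose g t : R := - e * sin t / f t.
pose E t (z : 'cV[R]_(2 + 2)) : R :=
  z (rshift 2 0) 0 * z (lshift 2 0) 0 + z (rshift 2 1) 0 * z (lshift 2 1) 0
  - g t * (z (rshift 2 0) 0 ^+ 2 + z (rshift 2 1) 0 ^+ 2).
pose D t (z : 'cV[R]_(2 + 2)) : R :=
  (z (lshift 2 0) 0 - g t * z (rshift 2 0) 0) ^+ 2
  + (z (lshift 2 1) 0 - g t * z (rshift 2 1) 0) ^+ 2
  + u / f t * (z (rshift 2 0) 0 ^+ 2 + z (rshift 2 1) 0 ^+ 2).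
have dE (z : 'cV[R]_(2 + 2)) t :
    is_derive t (1 : R) (fun s => E s (eta s *m z)) (D t (eta t *m z)).
  apply: is_derive_energy; first by rewrite gt_eqF // f0.
  apply: (@rotating_kepler_of_B1 R n e (fun s => eta s *m z)) => s.
  by rewrite mulmxA; apply: mx_is_deriveMr => i j; exact: deta.
have D_ge0 t z : 0 <= D t z.
  by rewrite !addr_ge0 ?sqr_ge0 // mulr_ge0 ?addr_ge0 ?sqr_ge0 // ltW // divr_gt0.
have g0 : g 0 = 0 by rewrite /g sin0 mulr0 mul0r.
have g2pi : g (2 * pi) = 0 by rewrite /g mulr_natl sin2pi mulr0 mul0r.
(* At time [0] the rate [D] is a positive definite form, because [g 0 = 0] and [u > 0]; this makes
   the energy growth strict. *)
have D0 z : D 0 z = 0 -> z = 0.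
  have uf0 : 0 < u / f 0 by rewrite divr_gt0.
  have nneg : 0 <= z (rshift 2 0) 0 ^+ 2 + z (rshift 2 1) 0 ^+ 2.
    by rewrite addr_ge0 ?sqr_ge0.
  rewrite /D g0 !mul0r !subr0 => /eqP.
  rewrite paddr_eq0 ?addr_ge0 ?sqr_ge0 ?(mulr_ge0 (ltW uf0) nneg) //.
  rewrite (mulrI_eq0 _ (lregP (lt0r_neq0 uf0))) !paddr_eq0 ?sqr_ge0 // !sqrf_eq0.
  case/andP=> /andP[/eqP p0 /eqP p1] /andP[/eqP q0 /eqP q1].
  exact: col4_eq0.
have dF t := is_derive_ptD (dE x t) (dE y t).
have /lt_eqF/negP : E 0 (eta 0 *m x) + E 0 (eta 0 *m y)
    < E (2 * pi) (eta (2 * pi) *m x) + E (2 * pi) (eta (2 * pi) *m y).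
  apply: (lt_of_derive_ge0_gt0 dF) => [t||]; first exact: addr_ge0.
    rewrite lt0r addr_ge0 // andbT eta0 !mul1mx; apply/eqP => /eqP.
    by rewrite paddr_eq0 // => /andP[/eqP/D0 ? /eqP/D0 ?]; apply: xy0.
  by rewrite mulr_gt0 // pi_gt0.
(* At both ends [E] is [<q, p>]. Passing from [(x, y)] to [(a x - b y, b x + a y)], the cross terms
   cancel and the total is multiplied by [a^2 + b^2 = 1]. *)
apply; apply/eqP; rewrite eta0 !mul1mx hx hy /E g0 g2pi !mul0r !subr0 !mxE.
move: w1; set a := complex.Re w; set b := complex.Im w => w1.
by rewrite -[LHS]mul1r -w1; ring.
Qed.

(** * Transfer from the first block to the essential part *)

Lemma B1_uniqueness (R : realType) (n : nat) (e : R) (m : nat)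
    (Z : R -> 'M[R]_(2 + 2, m)) :
  (2 < n)%N -> 0 <= e < 1 ->
  (forall t, mx_is_derive Z t (J R 2 *m B n e 1 t *m Z t)) -> Z 0 = 0 ->
  forall t, 0 <= t -> Z t = 0.
Proof.
move=> n2 he dZ Z0 t t0; apply/matrixP => i j; rewrite mxE.
pose X s := col j (Z s).
have dX s : mx_is_derive X s (J R 2 *m B n e 1 s *m X s).
  rewrite /X colE mulmxA => i' j'; under eq_fun do rewrite colE.
  exact: (mx_is_deriveMr _ (dZ s)).
have u0 : 0 < zn R n / lambda R n by rewrite divr_gt0 ?zn_gt0 ?lambda_gt0 // ltnW.
have X0 i' : X 0 i' 0 = 0 by rewrite /X Z0 !mxE.
(* The Gronwall constant comes from [f >= 1 - e > 0], uniformly in time. *)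
have hk s : 0 <= (1 + zn R n / lambda R n) / (1 + e * cos s)
    <= (1 + zn R n / lambda R n) / (1 - e).
  have e1 : 0 < 1 - e by rewrite subr_gt0; case/andP: he.
  have ef := conic_ge s he; have f0 := lt_le_trans e1 ef.
  have c0 : 0 <= 1 + zn R n / lambda R n by rewrite addr_ge0 ?ltW.
  by rewrite divr_ge0 ?(ltW f0) //= ler_wpM2l // lef_pV2.
have [p1 p2 q1 q2] := rotating_kepler_eq0 hk (rotating_kepler_of_B1 dX)
  (X0 _) (X0 _) (X0 _) (X0 _) t0.
by have /colP/(_ i) := col4_eq0 p1 p2 q1 q2; rewrite !mxE.
Qed.

(** [E] selects the coordinates of the first block; the same [E] serves momenta and positions
    because [diamond] keeps the two halves apart. [E *m E^T = 1%:M] makes [E2] right invertible. *)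
Lemma diamonds_first_block (R : realType) (p : nat -> nat)
    (M : R -> forall l, 'M[R]_(p l + p l)) (k : nat) :
  exists E : 'M[R]_(p 1%N, diamond_size p k.+1),
    let E2 := block_mx E 0 0 E in
    E *m E^T = 1%:M /\ forall t, E2 *m diamonds (M t) k.+1 = M t 1%N *m E2.
Proof.
elim: k => [|k [E [EE hE]]].
  (* [diamond_size p 1] is [0 + p 1], so the zero block here has no columns. *)
  exists (row_mx 0 1%:M) => E2; split=> [|t].
    by rewrite tr_row_mx trmx0 trmx1 mul_row_col mul0mx add0r mul1mx.
  rewrite [diamonds _ _]/= /diamond /E2 -{5}[M t 1%N]submxK !mulmx_block.
  rewrite !mul0mx !mulmx0 !addr0 !add0r !mul_row_block !mul_mx_row.
  by rewrite !mul0mx !mulmx0 !mul1mx !mulmx1 !addr0 !add0r.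
exists (row_mx E 0) => E2; split=> [|t].
  by rewrite tr_row_mx trmx0 mul_row_col mul0mx addr0.
have -> : diamonds (M t) k.+2 = diamond (diamonds (M t) k.+1) (M t k.+2) by [].
move: (diamonds (M t) k.+1) (hE t) => D.
rewrite /diamond /E2 -{1}[D]submxK -{1}[M t 1%N]submxK -{5}[M t 1%N]submxK.
rewrite !mulmx_block !mul0mx !mulmx0 !addr0 !add0r => /eq_block_mx [h1 h2 h3 h4].
rewrite !mul_row_block !mul_mx_row.
by rewrite !mul0mx !mulmx0 !addr0 h1 h2 h3 h4.
Qed.

Lemma B3_eigenvalue_of_B1 (R : realType) (n : nat) (e : R)
    (eta : R -> 'M[R]_(essential_size n + essential_size n)) :
  (2 < n)%N -> 0 <= e < 1 -> fundamental_solution (B3 n e) eta ->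
  exists2 eta1 : R -> 'M[R]_(2 + 2), fundamental_solution (B n e 1) eta1 &
    forall w, complex_eigenvalue (eta1 (2 * pi)) w ->
      complex_eigenvalue (eta (2 * pi)) w.
Proof.
move=> n2 he [eta0 deta].
have [E [EE hE]] : exists E : 'M[R]_(2, essential_size n),
    let E2 := block_mx E 0 0 E in
    E *m E^T = 1%:M /\ forall t, E2 *m B3 n e t = B n e 1 t *m E2.
  (* [half_leq n2] gives [1 <= n./2], so a first block exists. *)
  rewrite /essential_size /B3; case: n./2 (half_leq n2) => // k _.
  exact: (diamonds_first_block (fun t l => B n e l t)).
pose E2 : 'M[R]_(2 + 2, essential_size n + essential_size n) := block_mx E 0 0 E.
have E2E2 : E2 *m E2^T = 1%:M.
  rewrite tr_block_mx !trmx0 mulmx_block !mul0mx !mulmx0 !addr0 !add0r EE.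
  by rewrite -scalar_mx_block.
have E2J : E2 *m J R (essential_size n) = J R 2 *m E2.
  rewrite /J !mulmx_block !mul0mx !mulmx0 !addr0 !add0r.
  by rewrite !mulmxN !mulNmx !mulmx1 !mul1mx.
have dY t : mx_is_derive (fun s => E2 *m eta s) t
    (J R 2 *m B n e 1 t *m (E2 *m eta t)).
  have -> : J R 2 *m B n e 1 t *m (E2 *m eta t)
      = E2 *m (J R (essential_size n) *m B3 n e t *m eta t).
    by rewrite !mulmxA E2J -[J R 2 *m E2 *m B3 n e t]mulmxA hE mulmxA.
  by apply: mx_is_deriveMl => i j; exact: deta.
exists (fun s => E2 *m eta s *m E2^T).
  split=> [|t i j]; first by rewrite eta0 mulmx1.
  by rewrite mulmxA; exact: mx_is_deriveMr.
(* As functions of time, both sides solve the equation of the first block and equal [E2] at [0].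
   This turns a left eigenvector [v] of [eta1 (2 * pi)] into [v E2] for [eta (2 * pi)]. *)
have hZ : E2 *m eta (2 * pi) = E2 *m eta (2 * pi) *m E2^T *m E2.
  apply/eqP; rewrite -subr_eq0; apply/eqP.
  pose Z s := E2 *m eta s - E2 *m eta s *m (E2^T *m E2).
  rewrite -mulmxA -/(Z (2 * pi)); apply: (B1_uniqueness n2 he (Z := Z)).
  - move=> t; have := mx_is_deriveB (dY t) (mx_is_deriveMr (E2^T *m E2) (dY t)).
    by congr mx_is_derive; rewrite mulmxBr !mulmxA.
  - by rewrite /Z eta0 mulmx1 mulmxA E2E2 mul1mx subrr.
  - by rewrite mulr_ge0 // pi_ge0.
move=> w /eigenvalueP [v hv v0]; apply/eigenvalueP.
exists (v *m map_mx (real_complex R) E2).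
  by rewrite -mulmxA -map_mxM hZ map_mxM mulmxA hv scalemxAl.
(* [v E2] is nonzero since multiplying by [E2^T] recovers [v]. *)
apply: contraNneq v0 => /(congr1 (mulmx^~ (map_mx (real_complex R) E2^T))).
by rewrite -mulmxA -map_mxM E2E2 map_mx1 mulmx1 mul0mx => ->.
Qed.

Theorem theorem1p4 (R : realType) (n : nat) (e : R) :
  (3 <= n)%N -> 0 <= e < 1 ->
  (forall eta1 : R -> 'M[R]_(2 + 2),
     fundamental_solution (B n e 1) eta1 -> hyperbolic (eta1 (2 * pi))) /\
  (forall eta : R -> 'M[R]_(essential_size n + essential_size n),
     fundamental_solution (B3 n e) eta -> ~ spectrally_stable (eta (2 * pi))).
Proof.
move=> n3 he; split=> [eta1|eta heta stable]; first exact: B1_hyperbolic.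
have [eta1 heta1 sub] := B3_eigenvalue_of_B1 n3 he heta.
(* Hyperbolicity could hold vacuously without an eigenvalue; [R[i]] is algebraically closed and the
   size is positive, so one exists. *)
have [w hw] := eigenvalue_closed (map_mx (real_complex R) (eta1 (2 * pi))) isT.
exact: (B1_hyperbolic n3 he heta1 hw) (stable w (sub w hw)).
Qed.
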